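(* Let $R$ be an integral domain which is not a field, with quotient field $L$. Let $SD(R)$ be the set of nonzero strongly divisorial ideals of $R$, $O_t(R)$ the set of $t$-linked overrings of $R$, and $\phi_R: SD(R)\to O_t(R)\setminus\{L\}$ the map $I\mapsto I^{-1}=(I:I)$. 1) If $R$ is a valuation domain, then $\phi_R$ is surjective. Moreover, if $\dim R=n\geq 1$ is finite, then $R$ has exactly $n$ strongly divisorial ideals. 2) If $R$ is completely integrally closed, then $\phi_R$ is surjective if and only if $R$ is a one-dimensional valuation domain. 3) If $R$ is a Prüfer domain, then $\phi_R$ is surjective if and only if $R$ is a valuation domain.
   Context: An overring of $R$ is a ring $T$ with $R\subseteq T\subseteq L$. For a nonzero fractional ideal $I$ of $R$, $I^{-1}=(R:I)=\{x\in L: xI\subseteq R\}$, $I_v=(I^{-1})^{-1}$, $(I:I)=\{x\in L: xI\subseteq I\}$. An overring $T$ is $t$-linked over $R$ if, for each finitely generated ideal $I$ of $R$, $I^{-1}=R$ implies $(T:IT)=\{x\in L: xIT\subseteq T\}=T$. A nonzero ideal $I$ of $R$ is strongly divisorial if $I=II^{-1}=I_v$ (the ideal $R$ itself is strongly divisorial and is counted); in that case $I^{-1}=(I:I)$ is a $t$-linked overring of $R$ different from $L$, so $\phi_R$ is well defined. $R$ is completely integrally closed if every $x\in L$ for which there is a nonzero $d\in R$ with $dx^n\in R$ for all $n\geq 1$ belongs to $R$. *)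

(* Defs.v *)
From mathcomp Require Import all_boot all_order all_algebra.
From mathcomp Require Import all_classical.

Set Implicit Arguments.
Unset Strict Implicit.
Unset Printing Implicit Defensive.

Import GRing.Theory.
Local Open Scope classical_set_scope.
Local Open Scope ring_scope.

(* Ideals, fractional ideals and overrings of the domain [R] are all subsets
   of its quotient field [{fraction R}], in which [R] itself is identified with
   the image [base R] of the embedding [tofrac]. *)

Definition base (R : idomainType) : set {fraction R} := range (@tofrac R).
Arguments base R : clear implicits.

Definition colon (R : idomainType) (A B : set {fraction R}) :
    set {fraction R} :=
  [set x | forall y, B y -> A (x * y)].

(* Finite sums of products a * b with a in A and b in B. *)
Definition prod_set (R : idomainType) (A B : set {fraction R}) :
    set {fraction R} :=
  [set x | exists n (a b : nat -> {fraction R}),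
    (forall i, (i < n)%N -> A (a i) /\ B (b i)) /\
    x = \sum_(i < n) a i * b i].

Definition inv_ideal (R : idomainType) (I : set {fraction R}) :
    set {fraction R} :=
  colon (base R) I.

Definition v_closure (R : idomainType) (I : set {fraction R}) :
    set {fraction R} :=
  inv_ideal (inv_ideal I).

(* Integral ideals of R, possibly zero or equal to R. *)
Definition ideal_in (R : idomainType) (I : set {fraction R}) : Prop :=
  [/\ I `<=` base R, I 0,
      forall x y, I x -> I y -> I (x + y)
    & forall (r : R) x, I x -> I (tofrac r * x)].

Definition fg_ideal (R : idomainType) (I : set {fraction R}) : Prop :=
  exists s : seq R,
    I = [set x | exists c : nat -> R,
                   x = tofrac (\sum_(i < size s) c i * s`_i)].

Definition overring (R : idomainType) (T : set {fraction R}) : Prop :=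
  base R `<=` T /\ subring_closed [in T].

Definition t_linked (R : idomainType) (T : set {fraction R}) : Prop :=
  forall I : set {fraction R}, fg_ideal I ->
    inv_ideal I = base R -> colon T (prod_set I T) = T.

Definition strongly_divisorial (R : idomainType) (I : set {fraction R}) :
    Prop :=
  [/\ ideal_in I, I <> [set 0], I = prod_set I (inv_ideal I)
    & I = v_closure I].

Definition SD (R : idomainType) : set (set {fraction R}) :=
  [set I | strongly_divisorial I].
Arguments SD R : clear implicits.

Definition Ot (R : idomainType) : set (set {fraction R}) :=
  [set T | overring T /\ t_linked T].
Arguments Ot R : clear implicits.

Definition valuation_domain (R : idomainType) : Prop :=
  forall x : {fraction R}, x != 0 -> base R x \/ base R x^-1.

Definition completely_integrally_closed (R : idomainType) : Prop :=
  forall x : {fraction R},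
    (exists2 d : R, d != 0 &
       forall n, (1 <= n)%N -> base R (tofrac d * x ^+ n)) ->
    base R x.

(* Every nonzero finitely generated ideal is invertible. *)
Definition pruefer_domain (R : idomainType) : Prop :=
  forall I : set {fraction R}, fg_ideal I -> I <> [set 0] ->
    prod_set I (inv_ideal I) = base R.

(* [idealr_closed] includes properness, i.e. 1 \notin P. *)
Definition prime_ideal (R : idomainType) (P : set R) : Prop :=
  idealr_closed [in P] /\ prime_idealr_closed [in P].

Definition prime_chain (R : idomainType) (n : nat) : Prop :=
  exists P : nat -> set R,
    (forall i, (i <= n)%N -> prime_ideal (P i)) /\
    (forall i, (i < n)%N -> P i `<` P i.+1).

(* The Krull dimension of R is finite and equal to n. *)
Definition krull_dim_eq (R : idomainType) (n : nat) : Prop :=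
  prime_chain R n /\ forall m, prime_chain R m -> (m <= n)%N.

Section Phi.
Variable R : idomainType.
Local Notation L := {fraction R}.
Implicit Types (I J T : set L).

Lemma inv_ideal_colon I : SD R I -> inv_ideal I = colon I I.
Proof.
move=> [[IR I0 ID IM] _ eI _]; apply/seteqP; split=> x xI y Iy; last first.
  exact: IR (xI _ Iy).
rewrite eI; exists 1%N, (fun=> y), (fun=> x); split=> // .
by rewrite big_ord1 mulrC.
Qed.

Lemma inv_ideal_overring I : SD R I -> overring (inv_ideal I).
Proof.
move=> SI; rewrite (inv_ideal_colon SI); case: SI => [[IR I0 ID IM] _ _ _].
split; first by move=> _ [r _ <-] y; exact: IM.
have IN z : I z -> I (- z).
  by move=> /(IM (- 1)); rewrite rmorphN rmorph1 mulN1r.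
split.
- by apply/mem_set => y; rewrite mul1r.
- move=> x y /set_mem Hx /set_mem Hy; apply/mem_set => z Iz.
  by rewrite mulrBl; apply: ID; [exact: Hx | apply: IN; exact: Hy].
- move=> x y /set_mem Hx /set_mem Hy; apply/mem_set => z Iz.
  by rewrite -mulrA; apply/Hx/Hy.
Qed.

Lemma inv_ideal_t_linked I : SD R I -> t_linked (inv_ideal I).
Proof.
move=> SI J _ eJ; have [IT [T1 TB TM]] := inv_ideal_overring SI.
apply/seteqP; split=> [x xT z Iz|x xT _ [n [a [b [Hab ->]]]]].
  have : inv_ideal J (x * z).
    move=> y Jy; have := xT y; rewrite mulrAC; apply=> //.
    exists 1%N, (fun=> y), (fun=> 1); rewrite big_ord1 mulr1.
    by split=> // i _; split=> //; exact: set_mem T1.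
  by rewrite eJ.
have JR y : J y -> base R y.
  have : inv_ideal J 1 by rewrite eJ; exists 1; rewrite ?rmorph1.
  by move=> H /H; rewrite mul1r.
have TD u v : inv_ideal I u -> inv_ideal I v -> inv_ideal I (u + v).
  move=> Tu Tv; have T0 : 0 \in inv_ideal I by rewrite -(subrr 1); exact: TB.
  rewrite -[v]opprK -[- v]sub0r; apply: set_mem.
  by apply: (TB); [exact: mem_set | apply: TB => //; exact: mem_set].
elim: n Hab => [|n IHn] Hab.
  by rewrite big_ord0 mulr0; apply: IT; exists 0; rewrite ?rmorph0.
rewrite big_ord_recr mulrDr /=; apply: TD.
  by apply: IHn => i ltin; apply: Hab; exact: ltnW.
have [Ja Tb] := Hab n (ltnSn n).
apply: set_mem; apply: (TM); first exact: mem_set.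
by apply: (TM); apply: mem_set => //; apply/IT/JR.
Qed.

Lemma inv_ideal_neqT I :
  ~ GRing.field_axiom R -> SD R I -> inv_ideal I <> setT.
Proof.
move=> nF [[IR I0 _ _] In0 _ _] eT; apply: nF => r r0.
have [z [Iz z0]] : exists z, I z /\ z != 0.
  apply: contrapT => H; apply: In0; apply/seteqP; split=> [x Ix|_ ->//].
  by apply: contrapT => /eqP x0; apply: H; exists x.
have : inv_ideal I ((tofrac r)^-1 * z^-1) by rewrite eT.
move=> /(_ _ Iz); rewrite mulfVK // => -[u _ uE].
apply/unitrP; exists u.
suff ur : u * r = 1 by rewrite ur mulrC ur.
apply/eqP; rewrite -tofrac_eq rmorphM rmorph1 /= uE mulVf //.
by rewrite tofrac_eq0.
Qed.

Lemma inv_ideal_SD : ~ GRing.field_axiom R ->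
  set_fun (SD R) (Ot R `\ setT) (@inv_ideal R).
Proof.
move=> nF I SI; split; last exact: inv_ideal_neqT.
by split; [exact: inv_ideal_overring | exact: inv_ideal_t_linked].
Qed.

(* The whole quotient field L is [setT]. *)
Definition phi (nF : ~ GRing.field_axiom R) : {fun SD R >-> Ot R `\ setT} :=
  mkfun (inv_ideal_SD nF).

End Phi.

Definition phi_surjective (R : idomainType) (nF : ~ GRing.field_axiom R) :
    Prop :=
  set_surj (SD R) (Ot R `\ setT) (phi nF).

(* Main.v *)
Require Import Defs.
From mathcomp Require Import all_boot all_order all_algebra.
From mathcomp Require Import all_classical.
From mathcomp Require Import ring.

Set Implicit Arguments.
Unset Strict Implicit.
Unset Printing Implicit Defensive.

Import GRing.Theory.
Local Open Scope classical_set_scope.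
Local Open Scope card_scope.
Local Open Scope ring_scope.

(** Valuation domains: if [y] is not in [T] then [T/y] lies in [R], so
    [I = (R : T)] is nonzero, and the same remark gives [I^-1 = T].  Hence [SD R]
    is in bijection with the overrings [T <> L], i.e. with the localizations at
    nonzero primes, and the primes are exactly the members of a longest chain.

    Completely integrally closed domains: every [(I : I)] equals [R], so
    surjectivity leaves [R] and [L] as the only t-linked overrings.  Localizations
    are always t-linked; thus [R[1/a] = L] for every nonunit [a <> 0], which forces
    a finitely generated [I] with [I^-1 = R] to contain a unit.  So all overrings
    are t-linked, [R[x] = L] for [x] outside [R], and [1/x], being integral over
    [R], is in [R].

    Pruefer domains: let [c <> 0] be a nonunit, [P] a prime containing [c] and [I]
    strongly divisorial with [I^-1 = R_P].  Such an [I] is radical, and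
    [z / m] is in [R_P] for all [z] in [I] and all [m] of [R] outside [I]; applying
    this to [m ^+ 2] gives [I / m] inside [R], so [1/m] is in [R_P].  Hence [P] is
    contained in [I], [c / (1 - c)] is in [I], and [1 - c] is a unit: [R] is
    local. *)

(** * Overrings, finitely generated ideals and localizations *)

Section Overrings.
Variable R : idomainType.
Local Notation L := {fraction R}.
Local Notation "x %:F" := (tofrac x).
Implicit Types (I T : set L) (s : seq R) (S P : set R).

Lemma fractionE (x : L) : exists a b : R, b != 0 /\ x = a%:F / b%:F.
Proof.
elim/quotW: x => y; exists \n_y, \d_y; split; first exact: denom_ratioP.
have d0 : (\d_y)%:F != 0 :> L by rewrite tofrac_eq0 denom_ratioP.
apply: (mulIf d0); rewrite divfK //; unlock tofrac; rewrite -[LHS]FracField.pi_mul.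
apply/eqP; rewrite FracField.equivf_def /FracField.mulf /=.
by rewrite !numden_Ratio ?mulr1 ?oner_neq0 ?denom_ratioP // mulrC.
Qed.

Lemma base_tofrac (r : R) : base R r%:F.
Proof. by exists r. Qed.

Section OverringTheory.
Variables (T : set L) (oT : overring T).

Lemma overring1 : T 1.
Proof. by have [_ [/set_mem]] := oT. Qed.

Lemma overring_base x : base R x -> T x.
Proof. by have [+ _] := oT; apply. Qed.

Lemma overring_tofrac (r : R) : T r%:F.
Proof. exact/overring_base/base_tofrac. Qed.

Lemma overringM x y : T x -> T y -> T (x * y).
Proof.
by move=> Tx Ty; have [_ [_ _ TM]] := oT; apply/set_mem/TM; apply/mem_set.
Qed.

Lemma overringB x y : T x -> T y -> T (x - y).
Proof.
by move=> Tx Ty; have [_ [_ TB _]] := oT; apply/set_mem/TB; apply/mem_set.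
Qed.

Lemma overringD x y : T x -> T y -> T (x + y).
Proof.
move=> Tx Ty; rewrite -[y]opprK; apply: overringB => //.
by rewrite -sub0r; apply: overringB => //; rewrite -tofrac0; exact: overring_tofrac.
Qed.

Lemma overring_sum n (F : 'I_n -> L) :
  (forall i, T (F i)) -> T (\sum_(i < n) F i).
Proof.
move=> TF; apply: (big_ind T) => //; last exact: overringD.
by rewrite -tofrac0; exact: overring_tofrac.
Qed.

Lemma overringX x n : T x -> T (x ^+ n).
Proof.
move=> Tx; elim: n => [|n IHn]; first by rewrite expr0; exact: overring1.
by rewrite exprS; exact: overringM.
Qed.

End OverringTheory.

Lemma overringI T : (forall r : R, T r%:F) ->
  (forall x y, T x -> T y -> T (x - y)) ->
  (forall x y, T x -> T y -> T (x * y)) -> overring T.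
Proof.
move=> Tr TB TM; split; first by move=> _ [r _ <-].
split; first by apply/mem_set; rewrite -tofrac1.
- by move=> x y /set_mem Tx /set_mem Ty; apply/mem_set/TB.
- by move=> x y /set_mem Tx /set_mem Ty; apply/mem_set/TM.
Qed.

Lemma overring_baseR : overring (base R).
Proof.
apply: overringI => [r|_ _ [a _ <-] [b _ <-]|_ _ [a _ <-] [b _ <-]].
- exact: base_tofrac.
- by rewrite -tofracB; exact: base_tofrac.
- by rewrite -tofracM; exact: base_tofrac.
Qed.

Definition span s : set L :=
  [set x | exists c : nat -> R, x = (\sum_(i < size s) c i * s`_i)%:F].

Lemma fg_span s : fg_ideal (span s).
Proof. by exists s. Qed.

Lemma mem_span s (a : R) : a \in s -> span s a%:F.
Proof.
move=> sa; have ia : (index a s < size s)%N by rewrite index_mem.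
exists (fun i => (i == index a s)%:R); congr tofrac.
rewrite (bigD1 (Ordinal ia)) //= eqxx mul1r nth_index // big1 ?addr0 // => i.
by rewrite -val_eqE /= => /negPf ->; rewrite mul0r.
Qed.

Lemma overring_span T s x : overring T ->
  (forall a, a \in s -> T (x * a%:F)) -> forall y, span s y -> T (x * y).
Proof.
move=> oT Ts _ [c ->]; rewrite rmorph_sum mulr_sumr; apply: overring_sum => // i.
rewrite rmorphM mulrCA; apply: overringM => //; first exact: overring_tofrac.
by apply: Ts; exact: mem_nth.
Qed.

(** Membership in [(T : IT)] can be tested on generators of [I], and [T] always lies in [(T : IT)]
    because [I] lies in [R]. *)
Lemma t_linkedI T : overring T ->
  (forall s, inv_ideal (span s) = base R ->
     forall x, (forall a, a \in s -> T (x * a%:F)) -> T x) ->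
  t_linked T.
Proof.
move=> oT linkT _ [s ->] eI; apply/seteqP; split=> [x xT|x Tx _ [n [a [b [Hab ->]]]]].
  apply: (linkT s) => // a sa; apply: xT; exists 1%N, (fun=> a%:F), (fun=> 1).
  split; last by rewrite big_ord1 mulr1.
  by move=> i _; split; [exact: mem_span | exact: overring1].
rewrite mulr_sumr; apply: overring_sum => // i.
have [[c ->] Tb] := Hab i (ltn_ord i).
by do ![apply: overringM => //]; exact: overring_tofrac.
Qed.

(** Having a denominator in [S] is stated without division; when [0] is in [S], this set is all of
    [L]. *)
Definition loc S : set L := [set x | exists2 s, S s & base R (s%:F * x)].

Section Localization.
Variables (S : set R) (S1 : S 1) (SM : forall a b, S a -> S b -> S (a * b)).

Lemma loc_overring : overring (loc S).
Proof.
have bM := overringM overring_baseR; have bt := base_tofrac.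
apply: overringI => [r|x y [s Ss bx] [t St by_]|x y [s Ss bx] [t St by_]].
- by exists 1 => //; apply: bM.
- exists (s * t); first exact: SM.
  have -> : (s * t)%:F * (x - y) = t%:F * (s%:F * x) - s%:F * (t%:F * y) :> L.
    by rewrite rmorphM mulrBr /= mulrA [t%:F * _]mulrC !mulrA.
  by apply: (overringB overring_baseR); apply: bM.
- exists (s * t); first exact: SM.
  by rewrite rmorphM mulrACA; exact: bM.
Qed.

Lemma loc_common_denom s x : (forall a, a \in s -> loc S (x * a%:F)) ->
  exists2 t, S t & forall a, a \in s -> base R (t%:F * x * a%:F).
Proof.
elim: s => [|a s IHs] Hs; first by exists 1.
have [|t St Ht] := IHs; first by move=> b sb; apply: Hs; rewrite inE sb orbT.
have [u Su Hu] := Hs a (mem_head _ _).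
exists (t * u) => [|b]; first exact: SM.
have bM := overringM overring_baseR; have bt := base_tofrac.
rewrite inE => /predU1P[->|sb]; rewrite rmorphM /=.
  by rewrite -!mulrA; apply: bM.
by rewrite [t%:F * _]mulrC -!mulrA; apply: bM => //; rewrite mulrA; exact: Ht.
Qed.

(** By finite generation one [t] in [S] works for all generators at once, so [t * x] lies in
    [I^-1 = R]. *)
Lemma loc_t_linked : t_linked (loc S).
Proof.
apply: t_linkedI; first exact: loc_overring.
move=> s eI x /loc_common_denom[t St Ht]; exists t => //.
by rewrite -eI => y; apply: overring_span => //; exact: overring_baseR.
Qed.

Lemma loc_inv (s : R) : s != 0 -> S s -> loc S (s%:F)^-1.
Proof.
by move=> s0 Ss; exists s => //; rewrite divff ?tofrac_eq0 // -tofrac1; exact: base_tofrac.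
Qed.

End Localization.

Lemma base_inv (r : R) : base R (r%:F)^-1 -> r != 0 -> r \is a GRing.unit.
Proof.
move=> [u _ uE] r0; apply/unitrP; exists u.
suff ur : u * r = 1 by rewrite ur mulrC ur.
apply/eqP; rewrite -tofrac_eq rmorphM rmorph1 /= uE mulVf //.
by rewrite tofrac_eq0.
Qed.

Lemma prime_idealP P : prime_ideal P <->
  [/\ P 0, ~ P 1, forall a u v, P u -> P v -> P (a * u + v)
    & forall u v, P (u * v) -> P u \/ P v].
Proof.
split=> [[[P0 P1 PD] PM]|[P0 P1 PD PM]].
- split; first exact: set_mem.
  + by move=> /mem_set; exact/negP.
  + by move=> a u v Pu Pv; apply/set_mem/PD; apply/mem_set.
  + by move=> u v /mem_set/PM/orP[] /set_mem; [left|right].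
- split.
    split; first exact: mem_set.
      by apply/negP => /set_mem.
    by move=> a u v /set_mem Pu /set_mem Pv; apply/mem_set/PD.
  by move=> u v /set_mem/PM[] /mem_set ->; rewrite ?orbT.
Qed.

End Overrings.

(** * Strongly divisorial ideals and localizations at primes *)

Section StronglyDivisorial.
Variables (R : idomainType) (nF : ~ GRing.field_axiom R).
Local Notation L := {fraction R}.
Local Notation "x %:F" := (tofrac x).
Implicit Types (I T : set L) (s : seq R) (S P Q : set R).

Let baseR := overring_baseR R.

Lemma phi_surjectiveP : phi_surjective nF <->
  forall T, overring T -> t_linked T -> T <> setT ->
    exists2 I, SD R I & inv_ideal I = T.
Proof.
split=> [surj T oT lT TL|surj T [[oT lT] TL]]; last exact: surj.
by have [|I SI <-] := surj T; last exists I.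
Qed.

Lemma SD_neq0 I : SD R I -> exists2 d : R, d != 0 & I d%:F.
Proof.
move=> [[IR I0 _ _] In0 _ _]; apply: contrapT => H; apply: In0.
apply/seteqP; split=> [x Ix|_ -> //]; have [d _ dx] := IR x Ix.
rewrite -dx in Ix *; apply: contrapT => /eqP d0; apply: H; exists d => //.
by rewrite -tofrac_eq0.
Qed.

Lemma SD_base I : SD R I -> I `<=` base R.
Proof. by case=> -[]. Qed.

Lemma SD_inv_closed I x y : SD R I -> inv_ideal I x -> I y -> I (x * y).
Proof. by move=> SI; rewrite inv_ideal_colon //; apply. Qed.

Lemma SD_colon_inv I : SD R I -> colon (base R) (inv_ideal I) = I.
Proof. by case=> _ _ _ {2}->. Qed.

Lemma loc_prime_overring P : prime_ideal P -> overring (loc (~` P)).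
Proof.
move=> /prime_idealP[_ P1 _ PM]; apply: loc_overring => //= a b Pa Pb.
by case/PM.
Qed.

Lemma loc_prime_t_linked P : prime_ideal P -> t_linked (loc (~` P)).
Proof.
move=> /prime_idealP[_ P1 _ PM]; apply: loc_t_linked => //= a b Pa Pb.
by case/PM.
Qed.

Lemma prime_idealMl P (a b : R) : prime_ideal P -> P b -> P (a * b).
Proof. by move=> /prime_idealP[P0 _ PD _] Pb; rewrite -[_ * _]addr0; exact: PD. Qed.

Lemma prime_ideal1B P (c : R) : prime_ideal P -> P c -> ~ P (1 - c).
Proof.
move=> /prime_idealP[_ P1 PD _] Pc Pd; apply: P1.
by rewrite -(subrK c 1) -[1 - c]mul1r; exact: PD.
Qed.

Lemma prime_ideal_notin_neq0 P (c : R) : prime_ideal P -> ~ P c -> c != 0.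
Proof. by move=> /prime_idealP[P0 _ _ _]; apply: contra_notN => /eqP ->. Qed.

Lemma loc_primeV P (c : R) : prime_ideal P -> c != 0 ->
  loc (~` P) (c%:F)^-1 <-> ~ P c.
Proof.
move=> pP c0; split=> [[s nPs [r _ rE]] Pc|nPc]; last first.
  by apply: loc_inv => //; have /prime_idealP[] := pP.
apply: nPs; suff -> : s = r * c by exact: prime_idealMl.
by apply/eqP; rewrite -tofrac_eq rmorphM /= rE mulfVK // tofrac_eq0.
Qed.

Lemma loc_prime_proper P (c : R) : prime_ideal P -> P c -> c != 0 ->
  loc (~` P) <> setT.
Proof. by move=> pP Pc c0 eT; apply: (loc_primeV pP c0).1 Pc; rewrite eT. Qed.

(** A nonzero [c] belongs to a prime exactly when [1/c] is missing from the localization there, so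
    the localization determines the prime. *)
Lemma loc_primeS P Q : prime_ideal P -> prime_ideal Q ->
  loc (~` P) `<=` loc (~` Q) -> Q `<=` P.
Proof.
move=> pP pQ PQ c Qc; have [->|c0] := eqVneq c 0.
  by have /prime_idealP[] := pP.
by apply: contrapT => /(loc_primeV pP c0)/PQ/(loc_primeV pQ c0).
Qed.

Lemma loc_prime_inj P Q : prime_ideal P -> prime_ideal Q ->
  loc (~` P) = loc (~` Q) -> P = Q.
Proof. by move=> pP pQ e; apply/seteqP; split; apply: loc_primeS => //; rewrite e. Qed.

Lemma prime_ideal0 : prime_ideal ([set 0] : set R).
Proof.
apply/prime_idealP; split=> //=.
- by apply/eqP; exact: oner_neq0.
- by move=> a u v -> ->; rewrite mulr0 addr0.
- by move=> u v /eqP; rewrite mulf_eq0 => /orP[] /eqP; [left|right].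
Qed.

Lemma prime_neq0 P Q : prime_ideal P -> P `<` Q -> exists2 c, Q c & c != 0.
Proof.
move=> /prime_idealP[P0 _ _ _] [_ nQP]; apply: contrapT => H; apply: nQP => c Qc.
have [-> //|c0] := eqVneq c 0.
by case: H; exists c.
Qed.

(** These are the elements of [R] that are not units of [T]. Zero is listed apart because [0^-1] is
    [0], which belongs to [T]. *)
Definition center T : set R := [set r | r = 0 \/ ~ T (r%:F)^-1].

(** * Valuation domains *)

Section Valuation.
Hypothesis vR : valuation_domain R.

Lemma val_total (u v : R) : (exists w, v = w * u) \/ (exists w, u = w * v).
Proof.
have [->|u0] := eqVneq u 0; first by right; exists 0; rewrite mul0r.
have [->|v0] := eqVneq v 0; first by left; exists 0; rewrite mul0r.
have /vR : v%:F / u%:F != 0 :> L by rewrite mulf_neq0 ?invr_eq0 ?tofrac_eq0.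
case=> -[w _ wE]; [left|right]; exists w; apply/eqP; rewrite -tofrac_eq rmorphM /= wE.
  by rewrite divfK // tofrac_eq0.
by rewrite invf_div divfK // tofrac_eq0.
Qed.

(** For nonzero [t] in [T], one of [t/y] and [y/t] is in [R], and the second would put [y = (y/t) t]
    in [T]. *)
Lemma val_colonV T y : overring T -> ~ T y -> colon (base R) T y^-1.
Proof.
move=> oT nTy t Tt; have [->|t0] := eqVneq t 0.
  by rewrite mulr0 -tofrac0; exact: base_tofrac.
have y0 : y != 0.
  by apply/eqP => y0; apply: nTy; rewrite y0 -tofrac0; exact: overring_tofrac.
have /vR[//|] : y^-1 * t != 0 by rewrite mulf_neq0 ?invr_eq0.
rewrite invfM invrK => /(overring_base oT) Tyt; case: nTy.
by rewrite -[y](mulfVK t0); exact: overringM.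
Qed.

(** The conductor [I = (R : T)] is an ideal of [T], so once [I^-1 = T] is known, [I I^-1 = I T = I]
    and [I_v = (R : T) = I]. *)
Lemma val_SD T : overring T -> T <> setT ->
  SD R (colon (base R) T) /\ inv_ideal (colon (base R) T) = T.
Proof.
move=> oT TL; set I := colon (base R) T.
have IR : I `<=` base R by move=> x /(_ _ (overring1 oT)); rewrite mulr1.
have IT x t : I x -> T t -> I (x * t).
  by move=> Ix Tt u Tu; rewrite -mulrA; apply: Ix; exact: overringM.
have ID x y : I x -> I y -> I (x + y).
  by move=> Ix Iy t Tt; rewrite mulrDl; apply: (overringD baseR); [exact: Ix|exact: Iy].
have I0 : I 0 by move=> t _; rewrite mul0r -tofrac0; exact: base_tofrac.
have eT : inv_ideal I = T.
  apply/seteqP; split=> [x xI|t Tt x Ix]; last by rewrite mulrC; exact: Ix.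
  apply: contrapT => nTx; have Ix := val_colonV oT nTx.
  have x0 : x != 0.
    by apply/eqP => x0; apply: nTx; rewrite x0 -tofrac0; exact: overring_tofrac.
  apply: nTx; apply: contrapT => nTx.
  (* Every [t] in [T] is [x * (t/x)] with [t/x] in [I], so [T] lies in [R]; then [1] is in [I],
     which forces [x] into [R]. *)
  have I1 : I 1.
    by move=> t Tt; rewrite mul1r -[t](mulVKf x0); apply: xI; exact: IT.
  by apply: nTx; apply: (overring_base oT); rewrite -[x]mulr1; exact: xI.
split=> //; split.
- split=> // r x Ix; rewrite mulrC; apply: IT => //; exact: overring_tofrac.
- have /eqP/setTPn[y nTy] := TL.
  have Iy := val_colonV oT nTy => e; have : [set 0] y^-1 by rewrite -e.
  move=> /= /eqP; rewrite invr_eq0 => /eqP y0; apply: nTy.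
  by rewrite y0 -tofrac0; exact: overring_tofrac.
- rewrite eT; apply/seteqP; split=> [x Ix|_ [n [a [b [Hab ->]]]]].
    exists 1%N, (fun=> x), (fun=> 1); split; last by rewrite big_ord1 mulr1.
    by move=> i _; split=> //; exact: overring1.
  apply: (big_ind I) => // i _; have [Ia Tb] := Hab i (ltn_ord i); exact: IT.
- by rewrite /v_closure eT.
Qed.

Lemma val_phi_surjective : phi_surjective nF.
Proof.
apply/phi_surjectiveP => T oT _ TL; have [SI <-] := val_SD oT TL.
by exists (colon (base R) T).
Qed.

Lemma val_center_prime T : overring T -> prime_ideal (center T).
Proof.
move=> oT.
have nC (u : R) : ~ center T u -> u != 0 /\ T (u%:F)^-1.
  move=> nCu; split; first by apply/eqP => u0; apply: nCu; left.
  by apply: contrapT => ?; apply: nCu; right.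
have CM a u : center T u -> center T (a * u).
  case=> [->|nTu]; first by left; rewrite mulr0.
  have [->|a0] := eqVneq a 0; first by left; rewrite mul0r.
  right=> Tau; apply: nTu.
  have -> : (u%:F)^-1 = a%:F * ((a * u)%:F)^-1 :> L.
    by rewrite rmorphM invfM mulVKf // tofrac_eq0.
  by apply: overringM => //; exact: overring_tofrac.
apply/prime_idealP; split.
- by left.
- case=> [/eqP|]; first by rewrite oner_eq0.
  by rewrite tofrac1 invr1; apply; exact: overring1.
(* Divisibility is total, so [a * u + v] is a multiple of [u] or of [v]. *)
- move=> a u v Cu Cv; have [[w ->]|[w ->]] := val_total u v.
    by rewrite -mulrDl; exact: CM.
  by rewrite mulrA -[X in _ + X]mul1r -mulrDl; exact: CM.
- move=> u v Cuv; apply: contrapT => nC_.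
  have [|u0 Tu] := nC u; first by move=> ?; apply: nC_; left.
  have [|v0 Tv] := nC v; first by move=> ?; apply: nC_; right.
  case: Cuv => [/eqP|]; first by rewrite mulf_eq0 (negPf u0) (negPf v0).
  by rewrite rmorphM invfM; apply; exact: overringM.
Qed.

Lemma val_center_neq0 T : overring T -> T <> setT -> exists2 c, center T c & c != 0.
Proof.
move=> oT TL; have [SI eT] := val_SD oT TL.
have /eqP/setTPn[y nTy] := TL.
have : base R y^-1.
  by rewrite -[y^-1]mulr1; apply: (val_colonV oT nTy); exact: overring1.
move=> [c _ cE]; exists c; first by right; rewrite cE invrK.
rewrite -tofrac_eq0 cE invr_eq0; apply/eqP => y0; apply: nTy.
by rewrite y0 -tofrac0; exact: overring_tofrac.
Qed.

(** An element of [T] outside [R] is [1/s] with [s] in [R]; such an [s] is a unit of [T], hence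
    outside the center. *)
Lemma val_loc_center T : overring T -> loc (~` center T) = T.
Proof.
move=> oT; apply/seteqP; split=> [x [s nCs bx]|x Tx].
  have [s0 Ts] : s != 0 /\ T (s%:F)^-1.
    split; first by apply/eqP => s0; apply: nCs; left.
    by apply: contrapT => ?; apply: nCs; right.
  rewrite -[x](mulKf (x := s%:F)) ?tofrac_eq0 //.
  by apply: overringM => //; exact: overring_base.
have oL := loc_prime_overring (val_center_prime oT).
have [->|x0] := eqVneq x 0; first by rewrite -tofrac0; exact: overring_tofrac.
have [/(overring_base oL) //|[s _ sE]] := vR x0.
have s0 : s != 0 by rewrite -tofrac_eq0 sE invr_eq0.
rewrite -[x]invrK -sE; apply/(loc_primeV (val_center_prime oT) s0).
by case=> [/eqP|]; [rewrite (negPf s0)|rewrite sE invrK].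
Qed.

Lemma val_prime_total P Q : prime_ideal P -> prime_ideal Q -> P `<=` Q \/ Q `<=` P.
Proof.
move=> pP pQ; apply: contrapT => /not_orP[/nonsubset[u [Pu nQu]] nQP].
apply: nQP => v Qv; have [[w ->]|[w uE]] := val_total u v; first exact: prime_idealMl.
by case: nQu; rewrite uE; exact: prime_idealMl.
Qed.


Lemma prime_chain_mono n (P : nat -> set R) :
  (forall i, (i < n)%N -> P i `<` P i.+1) ->
  forall i j, (i < j <= n)%N -> P i `<` P j.
Proof.
move=> PS i; elim=> [|j IHj] //; rewrite ltnS leq_eqVlt => /andP[/predU1P[->|ij] jn].
  exact: PS.
have [PSj _] := PS _ jn; have [|Pij nPji] := IHj; first by rewrite ij ltnW.
by split=> [|Pji]; [exact: subset_trans PSj|apply/nPji/(subset_trans PSj)].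
Qed.

(** Primes of a valuation domain are totally ordered by inclusion, so a prime missing from a chain
    of maximal length could be inserted into it. *)
Lemma val_maximal_chain n (P : nat -> set R) :
  (forall m, prime_chain R m -> (m <= n)%N) ->
  (forall i, (i <= n)%N -> prime_ideal (P i)) ->
  (forall i, (i < n)%N -> P i `<` P i.+1) ->
  forall Q, prime_ideal Q -> exists2 i, (i <= n)%N & Q = P i.
Proof.
move=> maxn pP PS Q pQ; apply: contrapT => QP.
have neQ i : (i <= n)%N -> Q <> P i by move=> lein e; apply: QP; exists i.
(* [k] is the place where [Q] is to be inserted; the value [n.+1] stands for [Q] being contained in
   no [P i] with [i <= n]. *)
have [k kP kmin] : exists2 k, k = n.+1 \/ Q `<=` P k &
    forall i, i = n.+1 \/ Q `<=` P i -> (k <= i)%N.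
  have ex : exists k, `[< k = n.+1 \/ Q `<=` P k >] by exists n.+1; apply/asboolP; left.
  case: (ex_minnP ex) => k /asboolP Hk Hmin; exists k => // i Hi.
  by apply: Hmin; apply/asboolP.
have kn : (k <= n.+1)%N by apply: kmin; left.
have below i : (i < k)%N -> P i `<` Q.
  move=> ik; have lein : (i <= n)%N by rewrite -ltnS (leq_trans ik).
  have nQP : ~ Q `<=` P i by move=> H; have := kmin i (or_intror H); rewrite leqNgt ik.
  by split=> //; have [] := val_prime_total (pP i lein) pQ.
have above : (k <= n)%N -> Q `<` P k.
  move=> len; case: kP => [kE|QPk]; first by rewrite kE ltnn in len.
  by split=> // PkQ; apply: (neQ k len); apply/seteqP.
suff /maxn : prime_chain R n.+1 by rewrite ltnn.
exists (fun i => if (i < k)%N then P i else if i == k then Q else P i.-1).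
split=> i lein.
  case: ltngtP => // [ik|ki]; apply: pP.
    by rewrite -ltnS (leq_trans ik).
  by case: i lein ki.
have [ik|ki|ik] := ltngtP i k.
- have [ik1|ki1|_] := ltngtP i.+1 k.
  + by apply: PS; rewrite -ltnS (leq_trans ik1).
  + by rewrite ltnNge ik in ki1.
  + exact: below.
- rewrite ltnNge (ltnW (leq_trans ki _)) //= gtn_eqF ?(ltn_trans ki) //.
  by case: i lein ki => // i lein _; exact: PS.
- by rewrite -ik ltnNge leqnSn /= gtn_eqF //= ik; apply: above; rewrite -ik.
Qed.

(** Of the [n.+1] primes of a longest chain, the zero ideal localizes to [L], which is excluded; the
    other [n] correspond to the overrings [T <> L], hence to [SD R]. *)
Lemma val_card_SD n : krull_dim_eq R n -> SD R #= `I_n.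
Proof.
move=> [[P [pP PS]] maxn].
have Pmono := prime_chain_mono PS.
have chain Q := val_maximal_chain maxn pP PS (Q := Q).
(* The zero prime occurs in the chain, and only at index [0], since no prime lies strictly below
   it. *)
have P0 : P 0%N = [set 0].
  have [[//|j] jn eP] := chain _ prime_ideal0.
  have [_ []] := Pmono 0%N j.+1 jn; rewrite -eP => _ ->.
  by have /prime_idealP[] := pP 0%N isT.
have Pneq0 k : (k < n)%N -> exists2 c, P k.+1 c & c != 0.
  by move=> kn; apply: (prime_neq0 (pP 0%N isT)); exact: Pmono.
pose T k := loc (~` P k.+1).
have oT k : (k < n)%N -> overring (T k) by move=> kn; apply/loc_prime_overring/pP.
have TL k : (k < n)%N -> T k <> setT.
  by move=> kn; have [c Pc c0] := Pneq0 k kn; exact: loc_prime_proper (pP _ kn) Pc c0.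
apply: card_esym; apply/card_set_bijP; exists (fun k => colon (base R) (T k)); split.
- by move=> k /= kn; have [] := val_SD (oT k kn) (TL k kn).
- move=> k l; rewrite !inE /= => kn ln e.
  have eP : P k.+1 = P l.+1.
    apply: loc_prime_inj; [exact: pP|exact: pP|].
    have [_ ek] := val_SD (oT k kn) (TL k kn); have [_ el] := val_SD (oT l ln) (TL l ln).
    by rewrite -/(T k) -/(T l) -ek -el e.
  have [kl|lk|//] := ltngtP k l.
    by have [_] := Pmono k.+1 l.+1 (introT andP (conj kl ln)); rewrite eP; case.
  by have [_] := Pmono l.+1 k.+1 (introT andP (conj lk kn)); rewrite eP; case.
(* [I] is recovered from [I^-1] as [(R : I^-1)], and [I^-1] is the localization at its nonzero
   center, which is some [P k.+1]. *)
- move=> I SI; have oI := inv_ideal_overring SI; have IL := inv_ideal_neqT nF SI.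
  have [c Cc c0] := val_center_neq0 oI IL.
  have [[|k] kn eC] := chain _ (val_center_prime oI).
    by move: Cc c0; rewrite eC P0 => ->; rewrite eqxx.
  by exists k => //=; rewrite /T -eC val_loc_center // SD_colon_inv.
Qed.

End Valuation.

(** * Completely integrally closed domains *)

Lemma cic_SD_inv I : completely_integrally_closed R -> SD R I -> inv_ideal I = base R.
Proof.
move=> cR SI; apply/seteqP; split=> [x xI|x bx]; last first.
  exact: (overring_base (inv_ideal_overring SI)).
(* [I^-1] is a ring acting on [I], so [d x^n] stays in [I] for every [n]. *)
have [d d0 Id] := SD_neq0 SI; apply: cR; exists d => // n _; apply: (SD_base SI).
rewrite mulrC; apply: SD_inv_closed => //.
exact: (overringX (inv_ideal_overring SI)).
Qed.

Lemma size_tofrac (p : {poly R}) : size (map_poly (@tofrac R) p) = size p.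
Proof.
have [->|p0] := eqVneq p 0; first by rewrite map_poly0 !size_poly0.
by apply: size_map_poly_id0; rewrite tofrac_eq0 lead_coef_eq0.
Qed.

(** Put [y = 1/x = b/a] and [N = size p]. The factor [a ^+ N] clears the denominators of [y^n] for
    [n <= N], and the integral equation given by [p] expresses each higher power through lower ones,
    so [a ^+ N] is a common denominator of all powers of [y]. *)
Lemma cic_integral (x : L) (p : {poly R}) : completely_integrally_closed R ->
  x != 0 -> x^-1 = (map_poly (@tofrac R) p).[x] -> base R x^-1.
Proof.
move=> cR x0 px; have [a [b [b0 xE]]] := fractionE x.
have a0 : a != 0 by move: x0; rewrite xE mulf_eq0 tofrac_eq0 => /norP[].
have y0 : (x^-1) != 0 by rewrite invr_eq0.
apply: cR; set y := x^-1 in px y0 *; set N := size p.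
exists (a ^+ N); first by rewrite expf_neq0.
move=> n _; elim/ltn_ind: n => n IHn.
have [nN|Nn] := leqP n N.
  rewrite -(subnK nN) exprD rmorphM -mulrA; apply: (overringM baseR); first exact: base_tofrac.
  rewrite rmorphXn /= -exprMn; apply: (overringX baseR).
  by rewrite /y xE invf_div mulrCA divff ?mulr1 ?tofrac_eq0 //; exact: base_tofrac.
case: n Nn IHn => // n Nn IHn.
(* Multiply [y = p(1/y)] by [y^n]; since [i < N <= n], the natural subtraction [n - i] is exact. *)
have -> : y ^+ n.+1 = \sum_(i < N) (p`_i)%:F * y ^+ (n - i).
  rewrite exprSr {2}px horner_coef size_tofrac.
  rewrite mulr_sumr; apply: eq_bigr => i _; rewrite coef_map /= mulrCA; congr (_ * _).
  have lin : (i <= n)%N by rewrite ltnW // (leq_trans (ltn_ord i)).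
  by rewrite -[in LHS](subnK lin) exprD -mulrA -exprMn /y mulVf // expr1n mulr1.
rewrite mulr_sumr; apply: overring_sum => // i.
rewrite mulrCA; apply: (overringM baseR); first exact: base_tofrac.
by apply: IHn; rewrite ltnS leq_subr.
Qed.

Definition adjoin (x : L) : set L :=
  range (fun p : {poly R} => (map_poly (@tofrac R) p).[x]).

Lemma adjoin_overring x : overring (adjoin x).
Proof.
apply: overringI => [r|_ _ [p _ <-] [q _ <-]|_ _ [p _ <-] [q _ <-]].
- by exists r%:P => //; rewrite map_polyC hornerC.
- by exists (p - q) => //; rewrite rmorphB hornerD hornerN.
- by exists (p * q) => //; rewrite rmorphM hornerM.
Qed.

Lemma adjoin_id x : adjoin x x.
Proof. by exists 'X => //; rewrite map_polyX hornerX. Qed.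

(** * Domains whose only t-linked overrings are [R] and [L] *)

Section TwoOverrings.
Hypothesis two : forall T, overring T -> t_linked T -> T = base R \/ T = setT.

(** For [a != 0], the localization at the powers of [a] is t-linked and contains [1/a], which is not
    in [R], so it is [L]. *)
Lemma nonunit_pow_denom (a : R) (x : L) : a \isn't a GRing.unit ->
  exists n, base R (x * (a ^+ n)%:F).
Proof.
move=> Na; have [->|a0] := eqVneq a 0.
  by exists 1%N; rewrite expr1 tofrac0 mulr0 -tofrac0; exact: base_tofrac.
pose S : set R := range (fun n => a ^+ n).
have S1 : S 1 by exists 0%N.
have SM u v : S u -> S v -> S (u * v).
  by move=> [m _ <-] [n _ <-]; exists (m + n)%N => //; rewrite exprD.
have [eb|eT] := two (loc_overring S1 SM) (loc_t_linked S1 SM).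
  case/negP: Na; apply: base_inv => //; rewrite -eb; apply: loc_inv => //.
  by exists 1%N.
have [_ [n _ <-]] : loc S x by rewrite eT.
by rewrite mulrC; exists n.
Qed.

(* Multiply [x] by the highest power of each [a] in [s] in turn that keeps the
   product outside [R]. *)
Lemma nonunits_escape s (x : L) : (forall a, a \in s -> a \isn't a GRing.unit) ->
  ~ base R x -> exists2 y, ~ base R y & forall a, a \in s -> base R (y * a%:F).
Proof.
move=> Ns nx; elim: s Ns => [|a s IHs] Ns; first by exists x.
have [|y ny Hy] := IHs; first by move=> b sb; apply: Ns; rewrite inE sb orbT.
have ex : exists n, `[< base R (y * (a ^+ n)%:F) >].
  have [n ?] := nonunit_pow_denom y (Ns a (mem_head _ _)).
  by exists n; apply/asboolP.
case: (ex_minnP ex) => -[|n] /asboolP Hn nmin; first by rewrite expr0 mulr1 in Hn.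
exists (y * (a ^+ n)%:F) => [/asboolP/nmin|b]; first by rewrite ltnn.
rewrite inE => /predU1P[->|/Hy yb]; first by rewrite -mulrA -rmorphM -exprSr.
by rewrite mulrAC; apply: (overringM baseR) => //; exact: base_tofrac.
Qed.

(** If all generators of [I] were nonunits, [nonunits_escape], started at the inverse of a nonzero
    nonunit, would give an element of [I^-1] outside [R]. So [I^-1 = R] makes some generator a unit,
    and [x] is in [T] as soon as its product with that generator is. *)
Lemma overring_t_linked T : overring T -> t_linked T.
Proof.
move=> oT; apply: t_linkedI => // s eI x Tx.
have [a [sa Ua]] : exists a, a \in s /\ a \is a GRing.unit.
  apply: contrapT => H; apply: nF => b b0; apply: contrapT => /negP Nb.
  have [|nb|y ny Hy] := @nonunits_escape s (b%:F)^-1.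
  - by move=> a sa; apply/negP => Ua; apply: H; exists a.
  - by case/negP: Nb; exact: base_inv.
  - by apply: ny; rewrite -eI => z; exact: overring_span.
have -> : x = x * a%:F * (a^-1)%:F by rewrite -mulrA -rmorphM mulrV // rmorph1 mulr1.
by apply: overringM => //; [exact: Tx | exact: overring_tofrac].
Qed.

Lemma cic_valuation : completely_integrally_closed R -> valuation_domain R.
Proof.
move=> cR x x0; have [bx|nbx] := pselect (base R x); [by left | right].
have oA := adjoin_overring x.
have [eA|eA] := two oA (overring_t_linked oA).
  by case: nbx; rewrite -eA; exact: adjoin_id.
have [p _ px] : adjoin x x^-1 by rewrite eA.
exact: cic_integral cR x0 (esym px).
Qed.

(** The nonunits form a nonzero prime. Every nonzero prime localizes to [R], the only t-linked
    overring besides [L], so no second one exists. *)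
Lemma krull_dim_one : valuation_domain R -> krull_dim_eq R 1.
Proof.
move=> vR; split.
  exists (fun i => if i is 0 then [set 0] else center (base R)); split.
    by case=> [|i] _; [exact: prime_ideal0 | exact: val_center_prime].
  case=> // _; split=> [_ ->|]; first by left.
  have bL : base R <> setT.
    move=> bL; apply: nF => r r0; apply: base_inv => //; by rewrite bL.
  have [c Cc c0 /(_ _ Cc)/eqP] := val_center_neq0 vR baseR bL.
  by rewrite (negPf c0).
move=> [|[|m]] // [P [pP PS]].
have nz i : (i < m.+2)%N -> loc (~` P i.+1) = base R.
  move=> im; have [c Pc c0] := prime_neq0 (pP i (ltnW im)) (PS i im).
  have [//|eL] := two (loc_prime_overring (pP _ im)) (loc_prime_t_linked (pP _ im)).
  by case: (loc_prime_proper (pP _ im) Pc c0).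
have e : P 1%N = P 2%N by apply: loc_prime_inj; rewrite ?nz //; exact: pP.
by have [_] := PS 1%N isT; rewrite e; case.
Qed.

End TwoOverrings.

(** * Pruefer domains *)

Section Pruefer.
Hypothesis pR : pruefer_domain R.

(** Write [x = a/b]. Invertibility of [(a, b)] gives [1 = p a + q b] with [p] and [q] in its
    inverse; then [c = q b] works, because [c x = q a] and, for [a != 0], [(1 - c)/x = p b]. *)
Lemma pruefer_split (x : L) :
  exists c : R, base R (c%:F * x) /\ base R ((1 - c)%:F / x).
Proof.
have [a [b [b0 ->]]] := fractionE x.
have bF0 : b%:F != 0 :> L by rewrite tofrac_eq0.
have sb (c : R) : c \in [:: a; b] -> span [:: a; b] c%:F by exact: mem_span.
have s0 : span [:: a; b] <> [set 0].
  move=> s0; have : span [:: a; b] b%:F by apply: sb; rewrite !inE eqxx orbT.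
  by rewrite s0 => /eqP; rewrite (negPf bF0).
pose J (p : L) := base R (p * a%:F) /\ base R (p * b%:F).
have bM := overringM baseR; have bD := overringD baseR; have bt := @base_tofrac R.
have [p [q [[pa pb] [qa qb] e1]]] :
    exists p q, [/\ J p, J q & 1 = p * a%:F + q * b%:F].
  have : base R 1 by exact: overring1.
  rewrite -(pR (fg_span _) s0) => -[n [u [v [Huv ->]]]].
  pose K (z : L) := exists p q, [/\ J p, J q & z = p * a%:F + q * b%:F].
  apply: (big_ind K) => [|_ _ [p [q [[pa pb] [qa qb] ->]]] [p' [q' [[pa' pb'] [qa' qb'] ->]]]|i _].
  - exists 0, 0; rewrite /J !mul0r addr0 -tofrac0.
    by split; [split; exact: base_tofrac..|].
  - exists (p + p'), (q + q'); rewrite /J !mulrDl addrACA.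
    by split=> //; split; exact: bD.
  - have [[c ->] vs] := Huv i (ltn_ord i).
    exists ((c 0%N)%:F * v i), ((c 1%N)%:F * v i); split.
    + by split; rewrite -mulrA; apply: bM => //; apply/vs/sb; rewrite !inE eqxx ?orbT.
    + by split; rewrite -mulrA; apply: bM => //; apply/vs/sb; rewrite !inE eqxx ?orbT.
    + rewrite !big_ord_recl big_ord0 addr0 /= rmorphD !rmorphM /= mulrDl.
    by rewrite mulrAC [X in _ + X]mulrAC.
have [c _ cE] := qb; exists c; rewrite rmorphB rmorph1 /= cE; split.
  by rewrite -mulrA [b%:F * _]mulrC divfK.
have -> : 1 - q * b%:F = p * a%:F by rewrite e1 addrK.
have [->|a0] := eqVneq a 0; first by rewrite tofrac0 mulr0 mul0r -tofrac0.
by rewrite invf_div -mulrA [a%:F * _]mulrC divfK // tofrac_eq0.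
Qed.

Lemma pruefer_sqr (x : L) : base R (x ^+ 2) -> base R x.
Proof.
move=> bx2; have [->|x0] := eqVneq x 0; first by rewrite -tofrac0; exact: base_tofrac.
have [c [cx dx]] := pruefer_split x.
have -> : x = c%:F * x + (1 - c)%:F / x * x ^+ 2.
  by rewrite expr2 mulrA divfK // -mulrDl -rmorphD addrC subrK rmorph1 mul1r.
by apply: (overringD baseR) => //; exact: (overringM baseR).
Qed.

(** For [t] in [I^-1], [(x t)^2 = x^2 t^2] is in [I], hence in [R], so [x t] is in [R]; thus [x] is
    in [I_v = I]. *)
Lemma pruefer_SD_sqr I x : SD R I -> I (x ^+ 2) -> I x.
Proof.
move=> SI Ix2; have oI := inv_ideal_overring SI.
rewrite -(SD_colon_inv SI) => t tI; apply: pruefer_sqr; rewrite exprMn.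
by apply: (SD_base SI); rewrite mulrC; apply: SD_inv_closed => //; exact: (overringX oI).
Qed.

Section PrimeInverse.
Variables (P : set R) (pP : prime_ideal P) (I : set L).
Hypotheses (SI : SD R I) (eI : inv_ideal I = loc (~` P)).

(** Split [z/m] with [c]. If [c] is outside [P], it is the required denominator. Otherwise [1 - c]
    is invertible in [R_P = I^-1], and [m], the product of [(1 - c)/(z/m)] in [R] and [z/(1 - c)] in
    [I], would lie in [I]. *)
Lemma pruefer_SD_quotient (m : R) z : ~ I m%:F -> I z -> loc (~` P) (z / m%:F).
Proof.
move=> nIm Iz; have oT := loc_prime_overring pP.
have [->|z0] := eqVneq z 0.
  by rewrite mul0r -tofrac0; exact: overring_tofrac.
have m0 : m != 0.
  by apply: contra_notN nIm => /eqP ->; rewrite tofrac0; case: SI => -[].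
have [c [cx dx]] := pruefer_split (z / m%:F); exists c => // Pc.
have nPd := prime_ideal1B pP Pc; have d0 := prime_ideal_notin_neq0 pP nPd.
have dT : inv_ideal I ((1 - c)%:F)^-1 by rewrite eI; apply/(loc_primeV pP d0).
apply: nIm.
have -> : m%:F = ((1 - c)%:F / (z / m%:F)) * (((1 - c)%:F)^-1 * z) :> L.
  by rewrite invf_div mulrACA mulfV ?mul1r ?tofrac_eq0 // divfK.
apply: SD_inv_closed => //; last exact: SD_inv_closed.
by apply: overring_base => //; exact: inv_ideal_overring.
Qed.

(** If [m] were outside [I], so would be [m^2], and [(z/m)^2 = (z/m^2) z] would be in [I] for all
    [z] in [I]. Then [z/m] would be in [I], so [1/m] in [I^-1 = R_P], against [m] being in [P]. *)
Lemma prime_sub_SD (m : R) : P m -> I m%:F.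
Proof.
move=> Pm; apply: contrapT => nIm.
have m0 : m != 0.
  by apply: contra_notN nIm => /eqP ->; rewrite tofrac0; case: SI => -[].
suff : loc (~` P) (m%:F)^-1 by move/(loc_primeV pP m0).
rewrite -eI => z Iz; apply: (SD_base SI); apply: pruefer_SD_sqr => //.
have nIm2 : ~ I (m ^+ 2)%:F.
  by rewrite rmorphXn => /(pruefer_SD_sqr SI).
have -> : ((m%:F)^-1 * z) ^+ 2 = z / (m ^+ 2)%:F * z :> L.
  by rewrite rmorphXn /= exprMn exprVn mulrC [z ^+ 2]expr2 mulrAC.
by apply: SD_inv_closed => //; rewrite eI; exact: pruefer_SD_quotient.
Qed.

End PrimeInverse.
End Pruefer.

Lemma prime_containing (c : R) : c \isn't a GRing.unit ->
  exists2 P, prime_ideal P & P c.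
Proof.
move=> Nc; pose ideal A := forall a u v : R, A u -> A v -> A (a * u + v).
pose F A := A = set0 \/ [/\ A c, ~ A 1 & ideal A].
have [|A [FA maxA]] := @Zorn_bigcup R F.
  move=> C CF totC; have [[A CA [a Aa]]|C0] := pselect (exists2 A, C A & A !=set0).
    right; have FA B b : C B -> B b -> [/\ B c, ~ B 1 & ideal B].
      by move=> CB Bb; case: (CF B CB) => // B0; rewrite B0 in Bb.
    split.
    - by exists A => //; have [] := FA A a CA Aa.
    - by case=> B CB B1; have [_ /(_ B1)] := FA B 1 CB B1.
    - move=> r u v [B CB Bu] [D CD Dv].
      have [_ _ iB] := FA B u CB Bu; have [_ _ iD] := FA D v CD Dv.
      by have [BD|DB] := totC B D CB CD;
        [exists D => //; apply: iD => //; exact: BD | exists B => //; apply: iB => //; exact: DB].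
  left; apply/seteqP; split=> // x [A CA Ax]; apply: C0; exists A => //; by exists x.
have [Ac A1 iA] : [/\ A c, ~ A 1 & ideal A].
  case: FA => // A0; have [] := maxA (range (fun r => r * c)).
    rewrite A0; split=> [x //|/(_ c)]; apply; by exists 1; rewrite ?mul1r.
  right; split.
  - by exists 1; rewrite ?mul1r.
  - by case=> r _ /= rc; case/negP: Nc; apply/unitrP; exists r; rewrite [c * r]mulrC rc.
  - by move=> a _ _ [u _ <-] [v _ <-]; exists (a * u + v) => //; rewrite mulrDl mulrA.
have A0 : A 0 by rewrite -[0](subrr c) addrC -mulN1r; exact: iA.
exists A => //; apply/prime_idealP; split=> // u v Auv.
have [|nAu] := pselect (A u); [by left | right].
(* [B] is the ideal [A + R u]; by maximality [1 = r u + w] with [w] in [A], so [v = r (u v) + w v]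
   is in [A]. *)
pose B : set R := [set x | exists2 w, A w & exists r, x = r * u + w].
have AB : A `<=` B by move=> w Aw; exists w => //; exists 0; rewrite mul0r add0r.
have : B 1.
  apply: contrapT => B1; apply: (maxA B).
    split=> // BA; apply: nAu; apply: BA.
    by exists 0 => //; exists 1; rewrite mul1r addr0.
  right; split=> //; first exact: AB.
  move=> a _ _ [w Aw [r ->]] [w' Aw' [r' ->]].
  exists (a * w + w'); first exact: iA.
  by exists (a * r + r'); ring.
move=> [w Aw [r e]]; rewrite -[v]mul1r e.
have -> : (r * u + w) * v = r * (u * v) + (v * w + 0) by ring.
by apply: (iA) => //; exact: iA.
Qed.

(** * Surjectivity forces a valuation domain *)

Lemma pruefer_surj_local : pruefer_domain R -> phi_surjective nF ->
  forall c : R, c \is a GRing.unit \/ 1 - c \is a GRing.unit.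
Proof.
move=> pR /phi_surjectiveP surj c.
have [->|c0] := eqVneq c 0; first by right; rewrite subr0 unitr1.
have [|Nc] := boolP (c \is a GRing.unit); [by left | right].
have [P pP Pc] := prime_containing Nc.
have [I SI eI] := surj _ (loc_prime_overring pP) (loc_prime_t_linked pP)
  (loc_prime_proper pP Pc c0).
have Ic := prime_sub_SD pR pP SI eI Pc.
have nPd := prime_ideal1B pP Pc; have d0 := prime_ideal_notin_neq0 pP nPd.
apply: base_inv => //.
have -> : ((1 - c)%:F)^-1 = 1 + ((1 - c)%:F)^-1 * c%:F :> L.
  rewrite -tofrac_eq0 in d0; apply: (mulfI d0).
  by rewrite mulrDr mulVKf // mulr1 mulfV // -rmorphD subrK rmorph1.
apply: (overringD baseR); first exact: overring1.
apply: (SD_base SI); apply: SD_inv_closed => //.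
by rewrite eI; apply/(loc_primeV pP d0).
Qed.

(** Locality makes one of [c] and [1 - c] in [pruefer_split] a unit, which can be divided out. *)
Lemma pruefer_surj_valuation : pruefer_domain R -> phi_surjective nF ->
  valuation_domain R.
Proof.
move=> pR surj x x0; have [c [cx dx]] := pruefer_split pR x.
have unitE (u : R) y : u \is a GRing.unit -> base R (u%:F * y) -> base R y.
  move=> Uu buy; rewrite -[y]mul1r -(rmorph1 (@tofrac R)) -(mulVr Uu) rmorphM -mulrA.
  by apply: (overringM baseR) => //; exact: base_tofrac.
by have [Uc|Ud] := pruefer_surj_local pR surj c; [left|right]; apply: unitE; eauto.
Qed.

Lemma cic_surj_valuation : completely_integrally_closed R -> phi_surjective nF ->
  valuation_domain R /\ krull_dim_eq R 1.
Proof.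
move=> cR /phi_surjectiveP surj.
have two T : overring T -> t_linked T -> T = base R \/ T = setT.
  move=> oT lT; have [|TL] := pselect (T = setT); [by right | left].
  by have [I SI <-] := surj T oT lT TL; exact: cic_SD_inv.
have vR := cic_valuation two cR; split=> //; exact: krull_dim_one.
Qed.

End StronglyDivisorial.

Theorem proposition4p4 (R : idomainType) (nF : ~ GRing.field_axiom R) :
  [/\ valuation_domain R ->
        phi_surjective nF /\
        (forall n : nat, (1 <= n)%N -> krull_dim_eq R n -> SD R #= `I_n),
      completely_integrally_closed R ->
        (phi_surjective nF <-> valuation_domain R /\ krull_dim_eq R 1)
    & pruefer_domain R -> (phi_surjective nF <-> valuation_domain R)].
Proof.
split=> [vR|cR|pR].
- split; first exact: val_phi_surjective.
  by move=> n _ dimR; exact: val_card_SD.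
- by split=> [|[vR _]]; [exact: cic_surj_valuation | exact: val_phi_surjective].
- by split=> [|vR]; [exact: pruefer_surj_valuation | exact: val_phi_surjective].
Qed.
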